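(* Let $\Omega\subseteq\mathbb{R}^n$ be an open connected set contained in the open ball $\mathbb{B}_R(0)$ and star-shaped with respect to the open ball $\mathbb{B}_\rho(0)$, where $\rho, R>0$. Then for all $x,y\in\partial\Omega$ with angle $\alpha\in[0,\pi]$ between them we have $$ \big|\,\|x\|-\|y\|\,\big|\le 2\,\frac R\rho\sqrt{R^2-\rho^2}\,\sin\left(\frac\alpha2\right)=\frac R\rho\sqrt{R^2-\rho^2}\cdot\left\|\frac{x}{\|x\|}-\frac{y}{\|y\|}\right\|. $$ In particular, $$ \big|\,\|x\|-\|y\|\,\big|\le\frac R\rho\sqrt{R^2-\rho^2}\cdot\alpha . $$
   Context: $\|\cdot\|$ is the Euclidean norm, and $\mathbb{B}_t(0)$ is the open Euclidean ball of radius $t$ about the origin. $\Omega$ is star-shaped with respect to a subset $B\subseteq\Omega$ if for all $x\in\Omega$, $x_0\in B$ and $\lambda\in[0,1]$ one has $(1-\lambda)x+\lambda x_0\in\Omega$. In particular $\mathbb{B}_\rho(0)\subseteq\Omega$. *)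

(* Defs.v *)
From mathcomp Require Import all_boot all_order all_algebra.
From mathcomp Require Import all_classical all_reals all_analysis.
Set Implicit Arguments.
Unset Strict Implicit.
Unset Printing Implicit Defensive.
Import Order.TTheory GRing.Theory Num.Theory numFieldNormedType.Exports.
Local Open Scope classical_set_scope.
Local Open Scope ring_scope.

(* The norm `|x| that MathComp-Analysis puts on row vectors is the sup norm,
   so the Euclidean norm and its balls are defined here. Both norms induce the
   product topology, which is the library's topology on 'rV[K]_n; hence open,
   connected, closure and interior are used unchanged. *)
Definition dotv (K : realType) (n : nat) (x y : 'rV[K]_n) : K :=
  \sum_(i < n) x ord0 i * y ord0 i.

Definition enorm (K : realType) (n : nat) (x : 'rV[K]_n) : K :=
  Num.sqrt (dotv x x).

Definition eball0 (K : realType) (n : nat) (t : K) : set 'rV[K]_n :=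
  [set x | enorm x < t].

Definition boundary (T : topologicalType) (A : set T) : set T :=
  closure A `\` interior A.

Definition star_shaped (K : realType) (n : nat) (B Omega : set 'rV[K]_n) : Prop :=
  B `<=` Omega /\
  forall (x x0 : 'rV[K]_n) (lambda : K), Omega x -> B x0 -> 0 <= lambda <= 1 ->
    Omega ((1 - lambda) *: x + lambda *: x0).

(* This is meant for nonzero x and y: when one of them is zero the quotient is
   zero, by the convention 0^-1 = 0. *)
Definition is_angle (K : realType) (n : nat) (x y : 'rV[K]_n) (alpha : K) : Prop :=
  0 <= alpha <= pi /\ cos alpha = dotv x y / (enorm x * enorm y).

(* Main.v *)
Require Import Defs.
From mathcomp Require Import all_boot all_order all_algebra.
From mathcomp Require Import all_classical all_reals all_analysis.
From mathcomp Require Import ring lra.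
Import Order.TTheory GRing.Theory Num.Theory numFieldNormedType.Exports.
Local Open Scope classical_set_scope.
Local Open Scope ring_scope.
Set Implicit Arguments.
Unset Strict Implicit.

(** Let y be a boundary point. Shrinking towards the inner ball maps the closure
    of Omega into Omega, so Omega contains every point (1 - lambda) y + lambda b
    with lambda in ]0, 1] and |b| < rho ([star_shaped_closure]). A boundary point
    x is not in Omega, hence lies outside this cone with apex y tangent to the
    ball, that is |x - mu y| >= (1 - mu) rho for all mu in [0, 1[
    ([exterior_cone_dist]).

    The rest is plane geometry. Write r = |x| <= s = |y|, d = <x, y>, and let
    A = sqrt (r^2 - rho^2) and S = sqrt (s^2 - rho^2) be the tangent lengths from
    distances r and s to the ball. Squaring the exclusion gives a quadratic in mu
    that is nonnegative on [0, 1[; its value at the vertex yields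
    d <= rho^2 + A S. With cos a = rho / r and cos b = rho / s this reads
    cos alpha <= cos (b - a): the angle between x and y is at least the
    difference b - a of the angles under which the tangent points are seen.
    Since rho (s - r) factors through the same quantity,
    rho^2 (s - r)^2 = (r s - rho^2 - A S) (r s - rho^2 + A S),
    one gets rho^2 (s - r)^2 <= 2 S^2 (r s - d) ([tangent_cone_bound]). As
    r s - d = r s (1 - cos alpha) = 2 r s sin^2 (alpha / 2) and r, s <= R, this is
    the square of the claimed inequality. The chord equality is the expansion of
    |x / |x| - y / |y||^2 = 2 (1 - cos alpha), and the bound by alpha follows from
    sin t <= t. *)

(** * The Euclidean norm *)

Section EuclideanNorm.
Variables (K : realType) (n : nat).
Implicit Types (x y : 'rV[K]_n) (a b t : K).

Lemma dotvC x y : dotv x y = dotv y x.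
Proof. by apply: eq_bigr => i _; rewrite mulrC. Qed.

Lemma dotv_ge0 x : 0 <= dotv x x.
Proof. by apply: sumr_ge0 => i _; rewrite -expr2 sqr_ge0. Qed.

Lemma sqr_enorm x : enorm x ^+ 2 = dotv x x.
Proof. by rewrite sqr_sqrtr ?dotv_ge0. Qed.

Lemma enorm_ge0 x : 0 <= enorm x.
Proof. exact: sqrtr_ge0. Qed.

Lemma sqr_enorm_comb x y a b :
  enorm (a *: x + b *: y) ^+ 2 =
  a ^+ 2 * enorm x ^+ 2 + 2 * a * b * dotv x y + b ^+ 2 * enorm y ^+ 2.
Proof.
rewrite !sqr_enorm /dotv !mulr_sumr -!big_split /=.
by apply: eq_bigr => i _; rewrite !mxE; ring.
Qed.

Lemma enormZ a x : 0 <= a -> enorm (a *: x) = a * enorm x.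
Proof.
move=> a0; apply/eqP.
rewrite -(eqrXn2 (ltn0Sn 1)) ?mulr_ge0 ?enorm_ge0 // exprMn.
by rewrite -[a *: x]addr0 -(scale0r x) sqr_enorm_comb; apply/eqP; ring.
Qed.

Lemma enorm_continuous : continuous (@enorm K n).
Proof.
move=> x; apply: (@continuous_comp _ _ _ (fun x => dotv x x) Num.sqrt);
  last exact: sqrt_continuous.
rewrite /dotv; apply: (@continuous_big K _ +%R 0 _) => [|i _].
  exact: add_continuous.
by move=> {}x; apply: continuousM; apply: coord_continuous.
Qed.
End EuclideanNorm.

(** * Trigonometry *)

Lemma sin_le_id (K : realType) (t : K) : 0 <= t -> sin t <= t.
Proof.
move=> t0.
have [|c _] := @MVT_segment K sin cos 0 t t0 (fun x _ => is_derive_sin x).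
  exact/continuous_subspaceT/continuous_sin.
rewrite sin0 !subr0 => ->.
by rewrite ler_piMl // cos_le1.
Qed.

Lemma one_sub_cos (K : realType) (alpha : K) :
  1 - cos alpha = 2 * sin (alpha / 2) ^+ 2.
Proof.
have -> : cos alpha = cos ((alpha / 2) *+ 2).
  by congr cos; rewrite mulr2n; lra.
by rewrite cos_mulr2n cos2sin2; ring.
Qed.

(** * The plane estimate *)

(** The numbers r, s and d stand for |x|, |y| and <x, y>, and the hypothesis on
    mu says that x avoids the open tangent cone from y to the ball of radius rho.
    The factor s^2 - rho^2 is the squared tangent length from y; keeping it,
    rather than bounding it by s^2, is what produces sqrt (R^2 - rho^2) in the
    final constant. *)
Lemma tangent_cone_bound (K : realType) (rho r s d : K) :
  0 < rho -> rho <= r -> r <= s -> d <= r * s ->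
  (forall mu, 0 <= mu < 1 ->
     (1 - mu) ^+ 2 * rho ^+ 2 <= r ^+ 2 - 2 * mu * d + mu ^+ 2 * s ^+ 2) ->
  rho ^+ 2 * (s - r) ^+ 2 <= 2 * (s ^+ 2 - rho ^+ 2) * (r * s - d).
Proof.
move=> rho0 rhor rs drs H.
have S0 : 0 <= s ^+ 2 - rho ^+ 2 by nra.
have A0 : 0 <= r ^+ 2 - rho ^+ 2 by nra.
have [rEs|rNs] := eqVneq r s.
  have -> : s - r = 0 by rewrite rEs subrr.
  by rewrite expr0n /= mulr0 !mulr_ge0 // subr_ge0.
have ltrs : r < s by rewrite lt_neqAle rNs.
have S_gt0 : 0 < s ^+ 2 - rho ^+ 2 by nra.
set A := Num.sqrt (r ^+ 2 - rho ^+ 2).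
set S := Num.sqrt (s ^+ 2 - rho ^+ 2).
have A2 : A ^+ 2 = r ^+ 2 - rho ^+ 2 by rewrite sqr_sqrtr.
have S2 : S ^+ 2 = s ^+ 2 - rho ^+ 2 by rewrite sqr_sqrtr.
have An : 0 <= A by exact: sqrtr_ge0.
have Sn : 0 <= S by exact: sqrtr_ge0.
have AS : A <= S by rewrite ler_wsqrtr // lerD2r; nra.
(* For d = r s cos alpha, cos a = rho / r and cos b = rho / s this says that
   cos alpha <= cos (b - a). *)
have key : d - rho ^+ 2 <= A * S.
  have [d_le|d_gt] := leP d (rho ^+ 2).
    by apply: (@le_trans _ _ 0); [rewrite subr_le0 | rewrite mulr_ge0].
  (* The vertex of the quadratic in mu lies in [0, 1[ as rho^2 < d <= r s < s^2. *)
  have mu01 : 0 <= (d - rho ^+ 2) / (s ^+ 2 - rho ^+ 2) < 1.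
    apply/andP; split; first by rewrite divr_ge0 // subr_ge0 ltW.
    rewrite ltr_pdivrMr // mul1r ltrD2r (le_lt_trans drs) // expr2.
    by rewrite ltr_pM2r; lra.
  have := H _ mu01.
  set mu := _ / _ => Hmu.
  have Emu : mu * (s ^+ 2 - rho ^+ 2) = d - rho ^+ 2.
    by rewrite /mu mulfVK // gt_eqF.
  have disc : (d - rho ^+ 2) ^+ 2 <= (A * S) ^+ 2.
    rewrite exprMn A2 S2 -subr_ge0.
    have -> : (r ^+ 2 - rho ^+ 2) * (s ^+ 2 - rho ^+ 2) - (d - rho ^+ 2) ^+ 2
      = (s ^+ 2 - rho ^+ 2) * (r ^+ 2 - 2 * mu * d + mu ^+ 2 * s ^+ 2
         - (1 - mu) ^+ 2 * rho ^+ 2).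
      rewrite -Emu (_ : d = mu * (s ^+ 2 - rho ^+ 2) + rho ^+ 2); first by ring.
      by rewrite Emu; ring.
    by rewrite mulr_ge0 // subr_ge0.
  by rewrite -(@ler_pXn2r _ 2) // ?nnegrE ?mulr_ge0 // subr_ge0 ltW.
have fact : rho ^+ 2 * (s - r) ^+ 2 =
   (r * s - rho ^+ 2 - A * S) * (r * s - rho ^+ 2 + A * S).
  rewrite -subr_sqr exprMn A2 S2; ring.
have AS2 : A * S <= s ^+ 2 - rho ^+ 2 by rewrite -S2 expr2 ler_wpM2r.
have rs2 : r * s <= s ^+ 2 by rewrite expr2 ler_wpM2r; lra.
(* The factors in [fact] have nonnegative product, and the second is positive. *)
have gap : 0 <= r * s - rho ^+ 2 - A * S.
  have p : 0 < r * s - rho ^+ 2 + A * S.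
    apply: ltr_wpDr; first exact: mulr_ge0.
    rewrite subr_gt0 expr2; apply: (@le_lt_trans _ _ (r * rho)).
      by rewrite ler_wpM2r // ltW.
    by rewrite ltr_pM2l; lra.
  by rewrite -(pmulr_lge0 _ p) -fact mulr_ge0 ?sqr_ge0.
rewrite fact.
apply: (@le_trans _ _ ((r * s - rho ^+ 2 - A * S) * (2 * (s ^+ 2 - rho ^+ 2)))).
  by rewrite ler_wpM2l //; lra.
by rewrite mulrC ler_wpM2l ?mulr_ge0 //; lra.
Qed.

(** * Star-shaped sets around a ball *)

Section StarShaped.
Variables (K : realType) (n : nat) (Omega : set 'rV[K]_n) (rho R : K).
Hypothesis rho_gt0 : 0 < rho.
Hypothesis Omega_star : star_shaped (eball0 rho) Omega.
Implicit Types (x y z b : 'rV[K]_n).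

(** Replacing y by a nearby point z of Omega can be compensated by moving b to
    b + ((1 - lambda) / lambda) (y - z), which stays in the open ball when z is
    close enough to y. This is where lambda > 0 and the openness of the ball
    matter. *)
Lemma star_shaped_closure y b (lambda : K) :
  closure Omega y -> enorm b < rho -> 0 < lambda <= 1 ->
  Omega ((1 - lambda) *: y + lambda *: b).
Proof.
move=> cly brho /andP[l0 l1].
have ln0 : lambda != 0 by rewrite gt_eqF.
pose shift z := b + ((1 - lambda) / lambda) *: (y - z).
have shift_cont : {for y, continuous (fun z => enorm (shift z))}.
  apply: (@continuous_comp _ _ _ shift (@enorm K n)); last exact: enorm_continuous.
  apply: continuousD; first exact: cst_continuous.
  apply: continuousZ; first exact: cst_continuous.
  by apply: continuousB; [exact: cst_continuous | exact: cvg_id].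
have near_y : nbhs y [set z | enorm (shift z) < rho].
  apply: (shift_cont [set t | t < rho]).
  apply: open_nbhs_nbhs; split; first exact: open_lt.
  by rewrite /shift /= subrr scaler0 addr0.
have [z [Oz zrho]] := cly _ near_y.
have -> : (1 - lambda) *: y + lambda *: b
        = (1 - lambda) *: z + lambda *: shift z.
  by apply/rowP => i; rewrite !mxE; field.
by apply: (Omega_star.2) => //; rewrite ltW.
Qed.

(** If |y| > R, then the segment from y to 0 contains the point (R / |y|) y at
    distance exactly R from the origin, which lies in Omega since it comes
    strictly before y. *)
Lemma closure_enorm_le y :
  Omega `<=` eball0 R -> closure Omega y -> enorm y <= R.
Proof.
move=> Omega_bounded cly; rewrite leNgt; apply/negP => Ry.
have b0 : enorm (0 : 'rV[K]_n) = 0.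
  by rewrite -(scale0r 0) enormZ // mul0r.
have R0 : 0 < R.
  have := Omega_bounded _ (Omega_star.1 0 _); rewrite /eball0 /= b0; exact.
have y0 : 0 < enorm y by exact: lt_trans Ry.
have /star_shaped_closure : closure Omega y by [].
move=> /(_ 0 (1 - R / enorm y)); rewrite b0 => /(_ rho_gt0).
have l01 : 0 < 1 - R / enorm y <= 1.
  by rewrite subr_gt0 ltr_pdivrMr // mul1r Ry gerBl divr_ge0 // ltW.
move=> /(_ l01)/Omega_bounded; rewrite /eball0 /= scaler0 addr0 subKr.
by rewrite enormZ ?divr_ge0 ?ltW // mulfVK ?ltxx // gt_eqF.
Qed.

(** With lambda = 1 - mu, a violation would give |x - mu y| = lambda |b| with
    |b| < rho, placing x = mu y + lambda b in the cone from y, inside Omega. *)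
Lemma exterior_cone_dist x y (mu : K) :
  ~ Omega x -> closure Omega y -> 0 <= mu < 1 ->
  (1 - mu) * rho <= enorm (x - mu *: y).
Proof.
move=> nOx cly /andP[mu0 mu1]; rewrite leNgt; apply/negP => lt_rho.
have l0 : 0 < 1 - mu by rewrite subr_gt0.
apply: nOx.
have -> : x = (1 - (1 - mu)) *: y + (1 - mu) *: ((1 - mu)^-1 *: (x - mu *: y)).
  by rewrite scalerA divff ?gt_eqF // scale1r subKr addrC subrK.
apply: star_shaped_closure => //; last by rewrite l0 gerBl.
by rewrite enormZ ?invr_ge0 ?ltW // mulrC ltr_pdivrMr // mulrC.
Qed.

Lemma exterior_enorm_ge x : ~ Omega x -> rho <= enorm x.
Proof. by move=> nOx; rewrite leNgt; apply/negP => /Omega_star.1. Qed.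

(** Here c is the cosine of the angle, so that 2 (1 - c) is the squared chord
    between the unit vectors. The roles of x and y differ: the cone has its apex
    at y, the point farther from the origin. *)
Lemma sqr_enorm_diff_le x y (c : K) :
  Omega `<=` eball0 R -> ~ Omega x -> closure Omega y ->
  enorm x <= enorm y -> c <= 1 -> dotv x y = enorm x * enorm y * c ->
  (enorm x - enorm y) ^+ 2
    <= (R / rho) ^+ 2 * (R ^+ 2 - rho ^+ 2) * (2 * (1 - c)).
Proof.
move=> Omega_bounded nOx cly rs c1 dE.
have rhor := exterior_enorm_ge nOx.
have sR := closure_enorm_le Omega_bounded cly.
have r0 : 0 < enorm x by exact: lt_le_trans rhor.
have drs : dotv x y <= enorm x * enorm y.
  by rewrite dE ler_piMr // mulr_ge0 ?enorm_ge0.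
have H (mu : K) : 0 <= mu < 1 -> (1 - mu) ^+ 2 * rho ^+ 2
    <= enorm x ^+ 2 - 2 * mu * dotv x y + mu ^+ 2 * enorm y ^+ 2.
  move=> mu01; have gap := exterior_cone_dist nOx cly mu01.
  have mu1 : 0 <= 1 - mu by rewrite subr_ge0 ltW //; case/andP: mu01.
  have -> : enorm x ^+ 2 - 2 * mu * dotv x y + mu ^+ 2 * enorm y ^+ 2
          = enorm (x - mu *: y) ^+ 2.
    have -> : x - mu *: y = 1 *: x + - mu *: y by rewrite scale1r scaleNr.
    by rewrite sqr_enorm_comb; ring.
  by rewrite -exprMn ler_pXn2r ?nnegrE ?enorm_ge0 ?mulr_ge0 // ltW.
have := tangent_cone_bound rho_gt0 rhor rs drs H.
move: (enorm x) (enorm y) r0 rhor rs sR dE => r s r0 rhor rs sR dE B.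
rewrite -(@ler_pM2l _ (rho ^+ 2)) ?exprn_gt0 //.
have -> : rho ^+ 2 * ((R / rho) ^+ 2 * (R ^+ 2 - rho ^+ 2) * (2 * (1 - c)))
   = R ^+ 2 * (R ^+ 2 - rho ^+ 2) * (2 * (1 - c)).
  by field; rewrite gt_eqF.
rewrite -(sqrrN (r - s)) opprB; apply: le_trans B _.
have -> : 2 * (s ^+ 2 - rho ^+ 2) * (r * s - dotv x y)
        = r * s * (s ^+ 2 - rho ^+ 2) * (2 * (1 - c)) by rewrite dE; ring.
apply: ler_wpM2r; first by rewrite mulr_ge0 // subr_ge0.
have s0 : 0 <= s by apply: ltW; exact: lt_le_trans rs.
have R0 : 0 <= R by exact: le_trans sR.
apply: ler_pM; first exact: mulr_ge0 (ltW r0) s0.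
- by rewrite subr_ge0 ler_pXn2r ?nnegrE ?(ltW rho_gt0) // (le_trans rhor).
- by rewrite expr2 ler_pM ?(ltW r0) // (le_trans rs).
- by rewrite lerD2r ler_pXn2r ?nnegrE.
Qed.
End StarShaped.

(** * Radii of boundary points *)

Theorem theorem2p3 (K : realType) (n : nat) (Omega : set 'rV[K]_n) (rho R : K)
  (rho_gt0 : 0 < rho) (R_gt0 : 0 < R)
  (Omega_open : open Omega) (Omega_connected : connected Omega)
  (Omega_bounded : Omega `<=` eball0 R)
  (Omega_star : star_shaped (eball0 rho) Omega) :
  forall (x y : 'rV[K]_n) (alpha : K),
    boundary Omega x -> boundary Omega y -> is_angle x y alpha ->
    [/\ `|enorm x - enorm y|
          <= 2 * (R / rho) * Num.sqrt (R ^+ 2 - rho ^+ 2) * sin (alpha / 2),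
        2 * (R / rho) * Num.sqrt (R ^+ 2 - rho ^+ 2) * sin (alpha / 2)
          = R / rho * Num.sqrt (R ^+ 2 - rho ^+ 2)
            * enorm ((enorm x)^-1 *: x - (enorm y)^-1 *: y)
      & `|enorm x - enorm y|
          <= R / rho * Num.sqrt (R ^+ 2 - rho ^+ 2) * alpha].
Proof.
move=> x y alpha [clx nOx] [cly nOy] [/andP[alpha0 alphapi] cosE].
rewrite ((interior_id _).1 Omega_open) in nOx nOy.
have rhox := exterior_enorm_ge Omega_star nOx.
have rhoy := exterior_enorm_ge Omega_star nOy.
have xR := closure_enorm_le rho_gt0 Omega_star Omega_bounded clx.
have x0 : 0 < enorm x by exact: lt_le_trans rhox.
have y0 : 0 < enorm y by exact: lt_le_trans rhoy.
have dE : dotv x y = enorm x * enorm y * cos alpha.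
  by rewrite cosE mulrC mulfVK // mulf_neq0 ?gt_eqF.
have D0 : 0 <= R ^+ 2 - rho ^+ 2 by nra.
have sin0 : 0 <= sin (alpha / 2) by apply: sin_ge0_pi; lra.
have C0 : 0 <= R / rho * Num.sqrt (R ^+ 2 - rho ^+ 2).
  by rewrite mulr_ge0 ?sqrtr_ge0 // divr_ge0 ?ltW.
have chord : enorm ((enorm x)^-1 *: x - (enorm y)^-1 *: y)
           = 2 * sin (alpha / 2).
  apply/eqP; rewrite -(eqrXn2 (ltn0Sn 1)) ?enorm_ge0 ?mulr_ge0 //.
  rewrite -scaleNr sqr_enorm_comb dE.
  have -> : (2 * sin (alpha / 2)) ^+ 2 = 2 * (1 - cos alpha).
    by rewrite one_sub_cos; ring.
  by apply/eqP; field; rewrite !gt_eqF.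
have sqr_le : (enorm x - enorm y) ^+ 2
    <= (R / rho) ^+ 2 * (R ^+ 2 - rho ^+ 2) * (2 * (1 - cos alpha)).
  have [rs|/ltW sr] := leP (enorm x) (enorm y).
    exact: (@sqr_enorm_diff_le _ _ Omega).
  rewrite -(sqrrN (enorm x - enorm y)) opprB.
  apply: (@sqr_enorm_diff_le _ _ Omega) => //.
  by rewrite dotvC dE; ring.
have bound : `|enorm x - enorm y|
    <= 2 * (R / rho) * Num.sqrt (R ^+ 2 - rho ^+ 2) * sin (alpha / 2).
  rewrite -(@ler_pXn2r _ 2) ?nnegrE //; last first.
    by rewrite -(mulrA 2) mulr_ge0 // mulr_ge0.
  rewrite real_normK ?num_real // (le_trans sqr_le) // one_sub_cos.
  by rewrite !exprMn sqr_sqrtr // le_eqVlt; apply/orP; left; apply/eqP; ring.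
split=> //; first by rewrite chord; ring.
apply: le_trans bound _.
have -> : 2 * (R / rho) * Num.sqrt (R ^+ 2 - rho ^+ 2) * sin (alpha / 2)
        = R / rho * Num.sqrt (R ^+ 2 - rho ^+ 2) * (2 * sin (alpha / 2)).
  by ring.
apply: ler_wpM2l => //.
have := @sin_le_id K (alpha / 2); lra.
Qed.
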